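(* Let $p\ge 2$, let $F$ be a distribution on $\mathbb{R}^p$, let $X\sim F$, let $X_1,X_2,\ldots$ be independent random vectors with distribution $F$, let $\mathbb{X}_n=(X_1,\ldots,X_n)^T$, and let $t\in\mathbb{R}^p$. Suppose there is an $\alpha\ge 0$ such that (I) $E\,|X-t|^{-1/(1+\alpha)}<\infty$, and (II) there is a sequence $(t_n)_{n\in\mathbb{N}}$ of random $p$-vectors (defined on the same probability space as the $X_i$) satisfying $n^\alpha|t_n-t|\le T_n$ almost surely, where $(T_n)_{n\in\mathbb{N}}$ is a sequence of random variables that converges almost surely (if $\alpha>0$) or converges almost surely to $0$ (if $\alpha=0$). Then $S_n(\mathbb{X}_n,t_n)\to S(F,t)$ almost surely as $n\to\infty$. Moreover, if condition (I) holds and, instead of (II), $(t_n)$ is a sequence of random $p$-vectors such that $n^\alpha|t_n-t|$ is bounded in probability (if $\alpha>0$) or converges in probability to $0$ (if $\alpha=0$), then $S_n(\mathbb{X}_n,t_n)\to S(F,t)$ in probability.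
   Context: $|\cdot|$ denotes the Euclidean norm on $\mathbb{R}^p$. The spatial sign of $x\in\mathbb{R}^p$ is $s(x)=x/|x|$ for $x\neq 0$ and $s(0)=0$. For a distribution $F$ on $\mathbb{R}^p$ with $X\sim F$ and $t\in\mathbb{R}^p$, the spatial sign covariance matrix is $S(F,t)=E\{s(X-t)s(X-t)^T\}$. For the sample $\mathbb{X}_n=(X_1,\ldots,X_n)^T$ and a (possibly random) $u\in\mathbb{R}^p$, $S_n(\mathbb{X}_n,u)=\frac1n\sum_{i=1}^n s(X_i-u)s(X_i-u)^T$. *)

(* Defs.v *)
From HB Require Import structures.
From mathcomp Require Import all_boot all_order all_algebra.
From mathcomp Require Import all_classical all_reals all_analysis.
Set Implicit Arguments. Unset Strict Implicit. Unset Printing Implicit Defensive.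
Import Order.TTheory GRing.Theory Num.Theory.
Import numFieldNormedType.Exports.
Local Open Scope classical_set_scope.
Local Open Scope ring_scope.

Section Defs.
Variables (R : realType) (p : nat).

Definition enorm (x : 'rV[R]_p) : R := Num.sqrt (\sum_(j < p) x ord0 j ^+ 2).

Definition ssign (x : 'rV[R]_p) : 'rV[R]_p :=
  if x == 0 then 0 else (enorm x)^-1 *: x.

Definition ssign_outer (x : 'rV[R]_p) : 'M[R]_p := (ssign x)^T *m ssign x.

Definition borel_vec : set (set 'rV[R]_p) :=
  <<s [set A | exists (j : 'I_p) (B : set R),
          measurable B /\ A = (fun v : 'rV[R]_p => v ord0 j) @^-1` B] >>.
End Defs.

Section Prob.
Context {R : realType} {d : measure_display} {Omega : measurableType d}.
Variables (P : probability Omega R) (p : nat).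

Definition random_vec (Y : Omega -> 'rV[R]_p) : Prop :=
  forall B, borel_vec B -> measurable (Y @^-1` B).

Definition mutually_independent (X : nat -> Omega -> 'rV[R]_p) : Prop :=
  forall (J : seq nat) (B : nat -> set 'rV[R]_p), uniq J ->
    (forall i, i \in J -> borel_vec (B i)) ->
    P (\bigcap_(i in [set` J]) (X i @^-1` B i)) =
    (\prod_(i <- J) P (X i @^-1` B i))%E.

Definition identically_distributed (X : nat -> Omega -> 'rV[R]_p) : Prop :=
  forall i B, borel_vec B -> P (X i @^-1` B) = P (X 0%N @^-1` B).

Definition expect (f : Omega -> R) : R := fine (\int[P]_w (f w)%:E).

Definition SSCM (X : Omega -> 'rV[R]_p) (t : 'rV[R]_p) : 'M[R]_p :=
  \matrix_(i, j) expect (fun w => ssign_outer (X w - t) i j).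

(* S_n(X_n, u) = 1/n sum_{i=1}^n s(X_i - u) s(X_i - u)^T, with the
   sample X_1,...,X_n represented by X 0, ..., X (n-1) *)
Definition SSCM_n (X : nat -> Omega -> 'rV[R]_p) (n : nat)
    (u : Omega -> 'rV[R]_p) (w : Omega) : 'M[R]_p :=
  n%:R^-1 *: \sum_(i < n) ssign_outer (X i w - u w).

Definition neg_moment (X : Omega -> 'rV[R]_p) (t : 'rV[R]_p) (alpha : R)
  : \bar R :=
  \int[P]_w (if enorm (X w - t) == 0%R then +oo%E
             else (enorm (X w - t) `^ (- (1 + alpha)^-1))%:E).
End Prob.

(* Main.v *)
Require Import Defs.
From HB Require Import structures.
From mathcomp Require Import all_boot all_order all_algebra.
From mathcomp Require Import all_classical all_reals all_analysis.
From mathcomp Require Import measurable_realfun zify ring lra.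
Import Order.TTheory GRing.Theory Num.Theory.
Import numFieldNormedType.Exports.
Local Open Scope classical_set_scope.
Local Open Scope ring_scope.

(** The moment condition (I) enters only through P(X = t) = 0, and the rate of
    [tn] only through [tn -> t].  If [|u - t| <= delta], every entry of
    s(x-u)s(x-u)^T - s(x-t)s(x-t)^T is at most 2(p+1) delta/r when
    [|x - t| >= r], and at most 2 otherwise; hence |S_n(u) - S_n(t)| is at most
    2(p+1) delta/r plus twice the empirical frequency of [|X_i - t| < r].  By
    the strong law for bounded iid variables this frequency tends to
    P(|X - t| < r), which is small with r since t is not an atom, and
    S_n(t) -> S(F,t).  This bounds |S_n(u) - S(F,t)| by [eps + D_n] uniformly in
    [|u - t| <= delta], with [D_n -> 0] almost surely and hence in probability,
    which settles both modes of convergence.  The strong law follows from a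
    second-moment bound along the squares n^2. *)

(** * Convergence of means and of extended-real sequences *)

Section Means.
Context {R : realType}.

Lemma norm_sum_ord_le (y : nat -> R) (C : R) (m n : nat) :
  (forall i, `|y i| <= C) -> `|\sum_(m <= i < n) y i| <= (n - m)%:R * C.
Proof.
move=> yC; rewrite (le_trans (ler_norm_sum _ _ _))//.
rewrite (le_trans (ler_sum _ (fun i _ => yC i)))//.
by rewrite sumr_const_nat mulr_natl.
Qed.

(** Induction on the sharper bound [2 - 1/(m+1)]: with [x = m+1], the increment of this bound
    exceeds the new term by [1/(x (x+1)^2)]. *)
Lemma sum_inv_sqr_le2 (n : nat) :
  \sum_(0 <= k < n) (k.+1%:R ^+ 2)^-1 <= 2 :> R.
Proof.
suff H m : \sum_(0 <= k < m.+1) (k.+1%:R ^+ 2)^-1 <= 2 - m.+1%:R^-1 :> R.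
  case: n => [|n]; first by rewrite big_geq.
  by rewrite (le_trans (H n))// gerBl invr_ge0.
elim: m => [|m IH]; first by rewrite big_nat1 expr1n invr1; lra.
rewrite big_nat_recr//= (le_trans (lerD IH (lexx _)))//.
have m1 : 0 < m.+1%:R :> R by rewrite ltr0n.
rewrite -[m.+2%:R]natr1; set x : R := m.+1%:R in m1 *.
rewrite -subr_ge0.
have -> : 2 - (x + 1)^-1 - (2 - x^-1 + ((x + 1) ^+ 2)^-1) =
    (x * (x + 1) ^+ 2)^-1 by field; lra.
by rewrite invr_ge0 mulr_ge0 ?sqr_ge0// ltW.
Qed.

(** If [(k+1)^2 <= m < (k+2)^2], at most [2(k+1)] terms lie beyond the square; after division by
    [m >= (k+1)^2] they contribute at most [2C/(k+1)]. *)
Lemma cvg_mean_of_cvg_mean_squares (y : nat -> R) (C : R) :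
  (forall i, `|y i| <= C) ->
  (fun n => (\sum_(i < n.+1 ^ 2) y i) / n.+1%:R ^+ 2) @ \oo --> (0 : R) ->
  (fun n => n%:R^-1 * \sum_(i < n) y i) @ \oo --> (0 : R).
Proof.
move=> yC sq0.
have C0 : 0 <= C by exact: le_trans (yC 0%N).
pose v n : R := `|(\sum_(i < n.+1 ^ 2) y i) / n.+1%:R ^+ 2| + 2 * C * n.+1%:R^-1.
have v0 : v @ \oo --> (0 : R).
  rewrite -[0]addr0; apply: cvgD; first exact/norm_cvg0P.
  rewrite -[0](mulr0 (2 * C)); apply: cvgMr; exact: cvg_harmonic.
have root m : exists n, (n ^ 2 <= m < n.+1 ^ 2)%N.
  elim: m => [|m [n /andP[nm mn]]]; first by exists 0%N.
  have [mn'|] := ltnP m.+1 (n.+1 ^ 2); first by exists n; rewrite mn' ltnW.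
  move=> nm'; exists n.+1; rewrite nm'/= (leq_ltn_trans mn)// ltn_exp2r//.
apply/cvgrPdist_lt => e e0.
have [N _ vN] : \forall k \near \oo, `|v k| < e.
  by move/cvgrPdist_lt : v0 => /(_ _ e0); under eq_near do rewrite sub0r normrN.
(* From here on the integer square root of [m] is at least [N+1]; it is therefore some [k+1] with
   [N <= k], and the bound [v k] is available. *)
exists (N.+1 ^ 2)%N => // m /= Nm.
have [[|k]/andP[km mk]] := root m.
  by move: (leq_ltn_trans Nm mk); rewrite ltn_exp2r.
have Nk : (N <= k)%N by move: (leq_ltn_trans Nm mk); rewrite ltn_exp2r.
have m0 : 0 < m%:R :> R by rewrite ltr0n (leq_trans _ km)// expn_gt0.
have k0 : 0 < k.+1%:R :> R by rewrite ltr0n.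
have kmR : k.+1%:R ^+ 2 <= m%:R :> R by rewrite -natrX ler_nat.
rewrite sub0r normrN; apply: le_lt_trans (vN k Nk).
rewrite [leRHS]ger0_norm; last by rewrite /v addr_ge0// !mulr_ge0.
rewrite /v.
rewrite normrM [`|_^-1|]gtr0_norm ?invr_gt0//.
rewrite -(big_mkord xpredT y) (big_cat_nat _ km)//= big_mkord.
rewrite (le_trans (ler_wpM2l _ (ler_normD _ _))) ?invr_ge0 ?ler0n//.
rewrite mulrDr lerD//.
  rewrite normrM mulrC ler_wpM2l// [leRHS]gtr0_norm ?invr_gt0 ?exprn_gt0//.
  by rewrite lef_pV2 ?posrE ?exprn_gt0.
rewrite (le_trans (ler_wpM2l _ (norm_sum_ord_le _ _ _ _ yC))) ?invr_ge0 ?ler0n//.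
have mk2 : (m - k.+1 ^ 2)%:R <= 2 * k.+1%:R :> R.
  rewrite -natrM ler_nat leq_subLR -ltnS (leq_trans mk)//.
  by rewrite -[k.+2]addn1 sqrnD exp1n muln1; lia.
rewrite ler_pdivrMl// (le_trans (ler_wpM2r C0 mk2))//.
apply: (@le_trans _ _ (k.+1%:R ^+ 2 * (2 * C / k.+1%:R))).
  by rewrite le_eqVlt; apply/orP; left; apply/eqP; field; exact: lt0r_neq0.
by rewrite ler_wpM2r// !mulr_ge0.
Qed.

End Means.

(** The matrix norm is the maximum of the absolute entries, started at 0; hence the condition
    [0 <= b]. *)
Lemma norm_mx_le (R : realFieldType) (m n : nat) (M : 'M[R]_(m, n)) (b : R) :
  0 <= b -> (forall i j, `|M i j| <= b) -> `|M| <= b.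
Proof.
by move=> b0 Mb; rewrite [leLHS](mx_normrE M) bigmax_le// => ij _.
Qed.

Lemma cvg_sum0 (R : realType) (I : Type) (s : seq I) (f : I -> nat -> R) :
  (forall i, (fun n => f i n) @ \oo --> (0 : R)) ->
  (fun n => \sum_(i <- s) f i n) @ \oo --> (0 : R).
Proof.
move=> f0; elim: s => [|i s IH].
  have -> : (fun n => \sum_(i <- [::]) f i n) = cst 0.
    by apply/funext => n; rewrite big_nil.
  exact: cvg_cst.
have -> : (fun n => \sum_(i <- i :: s) f i n) =
    (fun n => f i n + \sum_(i <- s) f i n).
  by apply/funext => n; rewrite big_cons.
by rewrite -[X in _ --> X]addr0; apply: cvgD.
Qed.

Lemma cvge0_lt (R : realType) (u : nat -> \bar R) :
  u @ \oo --> 0%E -> forall e : R, 0 < e -> \forall n \near \oo, (u n < e%:E)%E.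
Proof.
move=> u0 e e0; apply: (u0 [set x | (x < e%:E)%E]); apply: open_nbhs_nbhs.
by split; [exact: open_ereal_lt_ereal|rewrite /= lte_fin].
Qed.

Lemma cvge0_of_le (R : realType) (u : nat -> \bar R) :
  (forall n, 0 <= u n)%E ->
  (forall e : R, 0 < e -> \forall n \near \oo, (u n <= e%:E)%E) ->
  u @ \oo --> 0%E.
Proof.
move=> u_ge0 u_le; apply/fine_cvgP; split.
  apply: filterS (u_le 1 ltr01) => n un.
  by rewrite ge0_fin_numE// (le_lt_trans un)// ltry.
apply/cvgrPdist_le => e e0; apply: filterS (u_le e e0) => n un /=.
rewrite sub0r normrN ger0_norm ?fine_ge0// -lee_fin fineK//.
by rewrite ge0_fin_numE// (le_lt_trans un)// ltry.
Qed.

Lemma near_lt_natr_powR (R : realType) (alpha A : R) : 0 < alpha ->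
  \forall n \near \oo, A < n%:R `^ alpha.
Proof.
(* Raised to the power [alpha], this threshold becomes [|A| + 1], which exceeds [A]. *)
move=> a0; apply: filterS (nbhs_infty_gtr ((`|A| + 1) `^ alpha^-1)) => n An.
have -> : A = A - (`|A| + 1) + (`|A| + 1) by rewrite subrK.
have := gt0_ltr_powR a0 (powR_ge0 _ _) (ler0n _ n) An.
rewrite -powRrM mulVf ?gt_eqF// powRr1//.
by have := ler_norm A; lra.
Qed.

Lemma measurable_norm_mx (R : realType) (d : measure_display)
    (T : measurableType d) (m n : nat) (M : T -> 'M[R]_(m, n)) :
  (forall i j, measurable_fun setT (fun w => M w i j)) ->
  measurable_fun setT (fun w => `|M w|).
Proof.
move=> mM; have -> : (fun w => `|M w|) =
    (fun w => \big[Num.max/0]_ij `|M w ij.1 ij.2|).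
  by apply/funext => w; exact: mx_normrE.
elim: (index_enum _) => [|ij s IH].
  by under eq_fun do rewrite big_nil; exact: measurable_cst.
under eq_fun do rewrite big_cons.
by apply: measurable_maxr => //; exact: measurableT_comp.
Qed.

(** The threshold for [n] is uniform in [x], so it can be used outcome by outcome and also yields
    inclusions of events. *)
Lemma near_le_of_rate_le (R : realType) (alpha M delta : R) :
  0 < alpha -> 0 < delta ->
  \forall n \near \oo, forall x, n%:R `^ alpha * x <= M -> x <= delta.
Proof.
move=> a0 d0; apply: filterS (near_lt_natr_powR _ alpha (M / delta) a0) => n.
rewrite ltr_pdivrMr// => Mn x xM; rewrite leNgt; apply/negP => dn.
by have := ler_wpM2l (powR_ge0 n%:R alpha) (ltW dn); lra.
Qed.

(** * Strong law of large numbers for bounded variables *)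

Section BoundedMoments.
Context {R : realType} {d : measure_display} {Omega : measurableType d}.
Variable P : probability Omega R.

Lemma bounded_integrable (f : Omega -> R) (C : R) :
  measurable_fun setT f -> (forall w, `|f w| <= C) ->
  P.-integrable setT (EFin \o f).
Proof.
move=> mf fC; apply: measurable_bounded_integrable => //.
- by rewrite ltey_eq fin_num_measure.
- exists C; split; first exact: num_real.
  by move=> M CM w _ /=; rewrite (le_trans (fC w))// ltW.
Qed.

Lemma Rintegral_bounded_sum (I : Type) (s : seq I) (f : I -> Omega -> R) (C : R) :
  (forall i, measurable_fun setT (f i)) -> (forall i w, `|f i w| <= C) ->
  Rintegral P setT (fun w => \sum_(i <- s) f i w) =
  \sum_(i <- s) Rintegral P setT (f i).
Proof.
move=> mf fC; elim: s => [|i s IH].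
  rewrite big_nil -[RHS](mul0r (fine (P setT))) -Rintegral_cst//.
  by apply: eq_Rintegral => w _; rewrite big_nil.
rewrite big_cons -IH -RintegralD//; last 2 first.
- exact: bounded_integrable (fC i).
- apply: (@bounded_integrable _ (\sum_(j <- s) C)).
    exact: measurable_sum.
  by move=> w; rewrite (le_trans (ler_norm_sum _ _ _))// ler_sum.
by apply: eq_Rintegral => w _; rewrite big_cons.
Qed.

(** By independence the joint law and the product of the marginals agree on rectangles, hence
    everywhere; Fubini then factors the integral. *)
Lemma Rintegral_mul_indep (U V : Omega -> R) (C : R) :
  measurable_fun setT U -> measurable_fun setT V ->
  (forall w, `|U w| <= C) -> (forall w, `|V w| <= C) ->
  (forall A B, measurable A -> measurable B ->
     P ((U @^-1` A) `&` (V @^-1` B)) = (P (U @^-1` A) * P (V @^-1` B))%E) ->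
  Rintegral P setT (fun w => U w * V w) =
  Rintegral P setT U * Rintegral P setT V.
Proof.
move=> mU mV UC VC indep.
pose XU : {RV P >-> R} :=
  HB.pack U (isMeasurableFun.Build _ _ _ _ _ mU).
pose XV : {RV P >-> R} :=
  HB.pack V (isMeasurableFun.Build _ _ _ _ _ mV).
have mUV : measurable_fun setT (fun w => (U w, V w)) by exact: measurable_fun_pair.
pose XUV : {RV P >-> (R * R)%type} :=
  HB.pack (fun w => (U w, V w)) (isMeasurableFun.Build _ _ _ _ _ mUV).
have jointE A : measurable A ->
    (distribution P XU \x distribution P XV)%E A = distribution P XUV A.
  by apply: product_measure_unique => B C' mB mC; exact: indep.
pose m (z : R * R) : \bar R := (z.1 * z.2)%:E.
have mm : measurable_fun setT m.
  by apply/measurable_EFinP; apply: measurable_funM.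
have iUV : P.-integrable setT (m \o XUV).
  apply: (@bounded_integrable _ (C * C)); first exact: measurable_funM.
  by move=> w /=; rewrite normrM ler_pM.
have EUV : (\int[P]_w (U w * V w)%:E =
    \int[distribution P XU \x distribution P XV]_z m z)%E.
  transitivity (\int[distribution P XUV]_z m z)%E.
    by rewrite integral_distribution.
  by apply: eq_measure_integral => A mA _; exact/esym/jointE.
(* Fubini requires integrability under the product measure; it is carried over from the joint
   law. *)
have im : (distribution P XU \x distribution P XV)%E.-integrable setT m.
  apply/integrableP; split => //.
  rewrite (eq_measure_integral (distribution P XUV)); last first.
    by move=> A mA _; exact: jointE.
  rewrite ge0_integral_distribution//; last exact: measurableT_comp.
  by have /integrableP[] := iUV.
rewrite /Rintegral EUV -integral12_prod_meas1// /fubini_F/=.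
have iU := bounded_integrable _ _ mU UC.
have iV := bounded_integrable _ _ mV VC.
have EV x : (\int[distribution P XV]_y m (x, y) =
             x%:E * (Rintegral P setT V)%:E)%E.
  rewrite /m /=.
  under eq_integral do rewrite EFinM.
  rewrite integralZl//; last first.
    exact: integrable_pushforward.
  rewrite integral_distribution//=.
  rewrite /Rintegral fineK//.
  exact: integrable_fin_num.
under eq_integral do rewrite EV.
rewrite integralZr//; last exact: integrable_pushforward.
rewrite integral_distribution//=.
by rewrite fineM//; exact: integrable_fin_num.
Qed.

(** Expanding the square, the mixed terms integrate to 0 and each diagonal term to at most [C^2]. *)
Lemma Rintegral_sqr_sum_uncorrelated (Y : nat -> Omega -> R) (C : R) (n : nat) :
  (forall i, measurable_fun setT (Y i)) -> (forall i w, `|Y i w| <= C) ->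
  (forall i j, i != j -> Rintegral P setT (fun w => Y i w * Y j w) = 0) ->
  Rintegral P setT (fun w => (\sum_(i < n) Y i w) ^+ 2) <= n%:R * C ^+ 2.
Proof.
move=> mY YC Y0.
have mYY i j : measurable_fun setT (fun w => Y i w * Y j w).
  exact: measurable_funM.
have YYC i j w : `|Y i w * Y j w| <= C ^+ 2 by rewrite normrM ler_pM.
have -> : Rintegral P setT (fun w => (\sum_(i < n) Y i w) ^+ 2) =
    \sum_(i < n) \sum_(j < n) Rintegral P setT (fun w => Y i w * Y j w).
  under [RHS]eq_bigr => i _.
    rewrite -(Rintegral_bounded_sum _ _ (fun j : 'I_n => fun w => Y i w * Y j w) (C ^+ 2))//.
    over.
  rewrite -(Rintegral_bounded_sum _ _
    (fun i : 'I_n => fun w => \sum_(j < n) Y i w * Y j w) (\sum_(j < n) C ^+ 2)).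
  - by apply: eq_Rintegral => w _; rewrite expr2 mulr_suml; apply: eq_bigr => i _;
      rewrite mulr_sumr.
  - by move=> i; exact: measurable_sum.
  - by move=> i w; rewrite (le_trans (ler_norm_sum _ _ _))// ler_sum.
have -> : n%:R * C ^+ 2 = \sum_(i < n) C ^+ 2.
  by rewrite sumr_const card_ord -[RHS]mulr_natl.
apply: ler_sum => i _.
rewrite (bigD1 i)//= big1 ?addr0; last by move=> j ji; rewrite Y0// eq_sym.
have <- : Rintegral P setT (cst (C ^+ 2)) = C ^+ 2.
  by rewrite Rintegral_cst//= probability_setT mulr1.
apply: le_Rintegral => //.
- exact: bounded_integrable.
- by apply: (bounded_integrable _ `|C ^+ 2|).
- by move=> w _; exact: le_trans (ler_norm _) (YYC i i w).
Qed.

(** [Z n] is the squared mean of the first [(n+1)^2] variables, of expectation at most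
    [C^2/(n+1)^2]. By Tonelli the series of the [Z n] has finite expectation, so it is almost surely
    finite and its terms tend to 0. The gaps between squares are filled by
    [cvg_mean_of_cvg_mean_squares]. *)
Lemma slln_bounded_uncorrelated (Y : nat -> Omega -> R) (C : R) :
  (forall i, measurable_fun setT (Y i)) -> (forall i w, `|Y i w| <= C) ->
  (forall i j, i != j -> Rintegral P setT (fun w => Y i w * Y j w) = 0) ->
  {ae P, forall w, (fun n => n%:R^-1 * \sum_(i < n) Y i w) @ \oo --> (0 : R)}.
Proof.
move=> mY YC Y0.
pose Z n w := ((\sum_(i < n.+1 ^ 2) Y i w) / n.+1%:R ^+ 2) ^+ 2.
have mZ n : measurable_fun setT (Z n).
  apply: measurable_funX; apply: measurable_funM => //; exact: measurable_sum.
have Z_ge0 n w : 0 <= Z n w by rewrite sqr_ge0.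
have intZ n : (\int[P]_w (Z n w)%:E <= (C ^+ 2 * (n.+1%:R ^+ 2)^-1)%:E)%E.
  have n0 : n.+1%:R != 0 :> R by rewrite pnatr_eq0.
  have mS : measurable_fun setT (fun w => (\sum_(i < n.+1 ^ 2) Y i w) ^+ 2).
    by apply: measurable_funX; exact: measurable_sum.
  have iS : P.-integrable setT (EFin \o (fun w => (\sum_(i < n.+1 ^ 2) Y i w) ^+ 2)).
    apply: (bounded_integrable _ (((n.+1 ^ 2)%:R * C) ^+ 2)) => // w.
    rewrite normrX lerXn2r ?nnegrE ?mulr_ge0//; first exact: le_trans (YC 0%N w).
    by rewrite -(big_mkord xpredT (Y ^~ w)) -[X in X%:R]subn0 norm_sum_ord_le.
  under eq_integral do rewrite /Z exprMn EFinM.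
  rewrite integralZr// -[X in (X * _)%E]fineK; last exact: integrable_fin_num.
  rewrite -EFinM lee_fin.
  rewrite (le_trans (ler_wpM2r _ (Rintegral_sqr_sum_uncorrelated _ _ _ mY YC Y0)))//.
  by rewrite natrX le_eqVlt; apply/orP; left; apply/eqP; field.
have sumZ : (\int[P]_w \sum_(0 <= n <oo) (Z n w)%:E < +oo)%E.
  rewrite integral_nneseries//; last first.
  - by move=> n w _; rewrite lee_fin.
  - by move=> n; apply/measurable_EFinP.
  apply: (@le_lt_trans _ _ (C ^+ 2 * 2)%:E); last exact: ltry.
  apply: lime_le.
    by apply: is_cvg_nneseries => n _ _; apply: integral_ge0 => w _; rewrite lee_fin.
  apply: nearW => n; rewrite (le_trans (lee_sum _ (fun k _ => intZ k)))//.
  by rewrite sumEFin lee_fin -mulr_sumr ler_wpM2l ?sqr_ge0 ?sum_inv_sqr_le2.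
have : {ae P, forall w, (\sum_(0 <= n <oo) (Z n w)%:E)%E \is a fin_num}.
  have /integrable_ae : P.-integrable setT (fun w => \sum_(0 <= n <oo) (Z n w)%:E)%E.
    apply/integrableP; split.
      apply: ge0_emeasurable_sum => //.
      - by move=> k w _ _; rewrite lee_fin.
      - by move=> k _; apply/measurable_EFinP.
    apply: le_lt_trans sumZ; rewrite le_eqVlt; apply/orP; left; apply/eqP.
    apply: eq_integral => w _; rewrite gee0_abs// nneseries_ge0// => k _ _.
    by rewrite lee_fin.
  by move=> /(_ measurableT); apply: filterS => w; exact.
apply: filterS => w Zfin.
apply: (cvg_mean_of_cvg_mean_squares (Y ^~ w) C) => [i|]; first exact: YC.
have Zcvg : (Z ^~ w) @ \oo --> (0 : R).
  apply: cvg_series_cvg_0; apply: nnseries_is_cvg => [n|]; first exact: Z_ge0.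
  by rewrite ltey_eq Zfin.
apply/cvgrPdist_lt => e e0.
move/cvgrPdist_lt : Zcvg => /(_ _ (exprn_gt0 2 e0)).
apply: filterS => n; rewrite !sub0r !normrN normrX.
by rewrite ltr_pXn2r ?nnegrE// ltW.
Qed.
End BoundedMoments.

Section BoundedIid.
Context {R : realType} {d : measure_display} {Omega : measurableType d}.
Variable P : probability Omega R.

Lemma measurable_ge_set (f : Omega -> R) (a : R) :
  measurable_fun setT f -> measurable [set w | a <= f w].
Proof.
move=> mf; have := mf measurableT `[a, +oo[%classic (measurable_itv _).
by rewrite setTI; congr measurable; apply/seteqP; split=> w /=;
  rewrite in_itv/= andbT.
Qed.

Lemma measurable_lt_set (f : Omega -> R) (a : R) :
  measurable_fun setT f -> measurable [set w | f w < a].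
Proof.
move=> mf; have := mf measurableT `]-oo, a[%classic (measurable_itv _).
by rewrite setTI; congr measurable; apply/seteqP; split=> w /=; rewrite in_itv.
Qed.

Lemma measurable_gt_set (f : Omega -> R) (a : R) :
  measurable_fun setT f -> measurable [set w | a < f w].
Proof.
move=> mf; have := mf measurableT `]a, +oo[%classic (measurable_itv _).
by rewrite setTI; congr measurable; apply/seteqP; split=> w /=;
  rewrite in_itv/= andbT.
Qed.

(** Dominated convergence for the indicators of these events: wherever [D n w] tends to 0, the
    indicator is eventually equal to 0. *)
Lemma ae_cvg0_probability (D : nat -> Omega -> R) (eps : R) :
  (forall n, measurable_fun setT (D n)) ->
  {ae P, forall w, (fun n => D n w) @ \oo --> (0 : R)} -> 0 < eps ->
  (fun n => P [set w | eps <= `|D n w|]) @ \oo --> 0%E.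
Proof.
move=> mD D0 e0.
have mE n : measurable [set w | eps <= `|D n w|].
  by apply: measurable_ge_set; exact: measurableT_comp.
pose f n w : \bar R := (\1_[set w | eps <= `|D n w|] w)%:E.
have mf n : measurable_fun setT (f n) by apply/measurable_EFinP.
have f0 : {ae P, forall w, setT w -> f ^~ w @ \oo --> 0%E}.
  apply: filterS D0 => w Dw _; apply: cvg_near_cst.
  move/cvgrPdist_lt : Dw => /(_ _ e0); apply: filterS => n.
  rewrite sub0r normrN => Dn; rewrite /f indicE memNset//=.
  by apply/negP; rewrite -ltNge.
have [] := @dominated_convergence _ _ _ P setT measurableT f (cst 0%E) (cst 1%E) mf _ f0.
- by [].
- exact: finite_measure_integrable_cst.
- by apply: aeW => w n _; rewrite /f/= lee_fin ger0_norm ?indicE//; case: (_ \in _).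
move=> _ _; rewrite integral0; apply: cvg_trans; apply: near_eq_cvg; apply: nearW => n.
by rewrite /= /f integral_indic// setIT.
Qed.

Context {d' : measure_display} {V : measurableType d'}.
Variable X : nat -> Omega -> V.
Hypothesis mX : forall i, measurable_fun setT (X i).
Hypothesis X_id : forall i B, measurable B -> P (X i @^-1` B) = P (X 0%N @^-1` B).
Hypothesis X_indep : forall i j A B, i != j -> measurable A -> measurable B ->
  P ((X i @^-1` A) `&` (X j @^-1` B)) = (P (X i @^-1` A) * P (X j @^-1` B))%E.

(** A change of variables turns both sides into integrals of [g] against the laws of the variables,
    and these laws coincide. *)
Lemma Rintegral_identically_distributed (g : V -> R) (C : R) (i : nat) :
  measurable_fun setT g -> (forall v, `|g v| <= C) ->
  Rintegral P setT (g \o X i) = Rintegral P setT (g \o X 0%N).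
Proof.
move=> mg gC.
have law j : Rintegral P setT (g \o X j) =
    fine (\int[pushforward P (X j)]_v (g v)%:E)%E.
  rewrite /Rintegral; congr fine; rewrite integral_pushforward//.
  - exact/measurable_EFinP.
  - apply: (bounded_integrable P (g \o X j) C) => [|w]; [exact: measurableT_comp|exact: gC].
rewrite !law; congr fine; apply: eq_measure_integral => A mA _.
exact: X_id.
Qed.

(** Centring [g] at its mean gives variables bounded by [C + |m|]. They are uncorrelated, since
    events about [h (X i)] are events about [X i] and thus inherit pairwise independence. *)
Lemma slln_bounded_iid (g : V -> R) (C : R) :
  measurable_fun setT g -> (forall v, `|g v| <= C) ->
  {ae P, forall w, (fun n => n%:R^-1 * \sum_(i < n) g (X i w)) @ \oo -->
     Rintegral P setT (g \o X 0%N)}.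
Proof.
move=> mg gC; set m := Rintegral P setT (g \o X 0%N).
pose h v := g v - m.
have mh : measurable_fun setT h by exact: measurable_funB.
have hC v : `|h v| <= C + `|m| by rewrite (le_trans (ler_normB _ _))// lerD.
have h0 i : Rintegral P setT (h \o X i) = 0.
  rewrite /h RintegralB//; last 2 first.
  - by apply: (bounded_integrable P (g \o X i) C) => [|w]; [exact: measurableT_comp|exact: gC].
  - exact: (bounded_integrable P (cst m) `|m|).
  rewrite Rintegral_cst//= probability_setT mulr1.
  by rewrite (Rintegral_identically_distributed _ C)// subrr.
have mhX i : measurable_fun setT (h \o X i) by exact: measurableT_comp.
have unc i j : i != j -> Rintegral P setT (fun w => h (X i w) * h (X j w)) = 0.
  move=> ij; rewrite (Rintegral_mul_indep P (h \o X i) (h \o X j) (C + `|m|))//;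
    [by rewrite h0 mul0r|by move=> w; exact: hC|by move=> w; exact: hC|].
  move=> A B mA mB; apply: (X_indep i j (h @^-1` A) (h @^-1` B)) => //.
  - by rewrite -[X in measurable X]setTI; exact: mh.
  - by rewrite -[X in measurable X]setTI; exact: mh.
have := slln_bounded_uncorrelated P (fun i => h \o X i) (C + `|m|) mhX
  (fun i w => hC (X i w)) unc.
(* At [n = 0] the inverse is 0 and the left side is [m] while the right side is 0; the identity from
   [n = 1] on suffices for the limit. *)
have meanE n w : (0 < n)%N -> m + n%:R^-1 * (\sum_(i < n) h (X i w)) =
    n%:R^-1 * \sum_(i < n) g (X i w).
  move=> n0; rewrite /h sumrB sumr_const card_ord mulrBr -[m *+ n]mulr_natl mulrA.
  by rewrite mulVf ?mul1r ?subrKC// pnatr_eq0 -lt0n.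
apply: filterS => w /(cvgD (cvg_cst m)); rewrite addr0.
by apply: cvg_trans; apply: near_eq_cvg; exists 1%N => // n; exact: meanE.
Qed.
End BoundedIid.

(** * Spatial signs *)

Section SpatialSign.
Context {R : realType} {p : nat}.
Implicit Types x y : 'rV[R]_p.

Lemma enorm_ge0 x : 0 <= enorm x. Proof. exact: sqrtr_ge0. Qed.

Lemma sqr_enorm x : enorm x ^+ 2 = \sum_(j < p) x ord0 j ^+ 2.
Proof. by rewrite sqr_sqrtr// sumr_ge0// => j _; rewrite sqr_ge0. Qed.

Lemma coord_le_enorm x j : `|x ord0 j| <= enorm x.
Proof.
rewrite -(@ler_pXn2r _ 2) ?nnegrE ?enorm_ge0// sqr_enorm real_normK ?num_real//.
by rewrite (bigD1 j)//= lerDl sumr_ge0// => k _; rewrite sqr_ge0.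
Qed.

Lemma enorm0 : enorm (0 : 'rV[R]_p) = 0.
Proof.
by rewrite /enorm big1 ?sqrtr0// => j _; rewrite mxE expr0n.
Qed.

Lemma enormN x : enorm (- x) = enorm x.
Proof.
by rewrite /enorm; congr Num.sqrt; apply: eq_bigr => j _; rewrite mxE sqrrN.
Qed.

Lemma enorm_eq0 x : (enorm x == 0) = (x == 0).
Proof.
apply/eqP/eqP => [x0|->]; last exact: enorm0.
apply/rowP => j; rewrite mxE; apply/eqP; rewrite -normr_le0 -x0.
exact: coord_le_enorm.
Qed.

(* At [x = 0] both sides vanish, since [0^-1 = 0]. *)
Lemma ssign_coordE x j : ssign x ord0 j = x ord0 j * (enorm x)^-1.
Proof.
rewrite /ssign; case: eqP => [->|_]; first by rewrite !mxE mul0r.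
by rewrite mxE mulrC.
Qed.

(** Multiplying instead of dividing covers [x = 0], so that [ssign_dist] needs no case distinction
    at the origin. *)
Lemma ssign_enorm x j : ssign x ord0 j * enorm x = x ord0 j.
Proof.
rewrite ssign_coordE; have [x0|x0] := eqVneq (enorm x) 0.
  by move/eqP : x0; rewrite enorm_eq0 => /eqP ->; rewrite mxE !mul0r.
by rewrite mulfVK.
Qed.

Lemma norm_ssign_le1 x j : `|ssign x ord0 j| <= 1.
Proof.
have [x0|x0] := eqVneq (enorm x) 0.
  by rewrite ssign_coordE x0 invr0 mulr0 normr0.
have x_gt0 : 0 < enorm x by rewrite lt0r x0 enorm_ge0.
rewrite -(ler_pM2r x_gt0) mul1r -[X in _ * X](ger0_norm (enorm_ge0 x)) -normrM.
by rewrite ssign_enorm coord_le_enorm.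
Qed.

(* Factoring [|x|^2 - |y|^2] coordinatewise gives a Lipschitz bound (with a
   suboptimal constant) that does not go through the triangle inequality. *)
Lemma enorm_dist x y : `|enorm x - enorm y| <= p%:R * enorm (x - y).
Proof.
have [s0|s0] := eqVneq (enorm x + enorm y) 0.
  have /eqP -> : enorm x == 0 by rewrite eq_le enorm_ge0 -s0 lerDl enorm_ge0.
  have /eqP -> : enorm y == 0 by rewrite eq_le enorm_ge0 -s0 lerDr enorm_ge0.
  by rewrite subrr normr0 mulr_ge0 ?enorm_ge0.
have s_gt0 : 0 < enorm x + enorm y by rewrite lt0r s0 addr_ge0 ?enorm_ge0.
rewrite -(ler_pM2r s_gt0) -[X in _ * X <= _](ger0_norm (ltW s_gt0)) -normrM.
rewrite -subr_sqr !sqr_enorm -sumrB (le_trans (ler_norm_sum _ _ _))//.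
have -> : p%:R * enorm (x - y) * (enorm x + enorm y) =
    \sum_(j < p) enorm (x - y) * (enorm x + enorm y).
  by rewrite sumr_const card_ord -[RHS]mulr_natl mulrA.
apply: ler_sum => j _; rewrite subr_sqr normrM ler_pM//.
  by rewrite (le_trans _ (coord_le_enorm _ j))// !mxE.
by rewrite (le_trans (ler_normD _ _))// lerD ?coord_le_enorm.
Qed.

(** Uses [|y| (s(x) - s(y)) = (x - y) - s(x) (|x| - |y|)]: the first term contributes 1 to the
    constant, the second [p] through [enorm_dist]. Only [|y|] appears as a factor, so [x] may be
    arbitrarily close to 0. *)
Lemma ssign_dist x y j :
  `|ssign x ord0 j - ssign y ord0 j| * enorm y <= p.+1%:R * enorm (x - y).
Proof.
rewrite -[X in _ * X <= _](ger0_norm (enorm_ge0 y)) -normrM.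
have -> : (ssign x ord0 j - ssign y ord0 j) * enorm y =
    (x - y) ord0 j - ssign x ord0 j * (enorm x - enorm y).
  by rewrite !mxE mulrBl mulrBr !ssign_enorm; ring.
rewrite (le_trans (ler_normB _ _))// -natr1 mulrDl mul1r addrC lerD//.
  rewrite normrM -[leRHS]mul1r ler_pM// ?norm_ssign_le1//.
  exact: enorm_dist.
exact: coord_le_enorm.
Qed.

Lemma ssign_outerE x i j : ssign_outer x i j = ssign x ord0 i * ssign x ord0 j.
Proof. by rewrite !mxE big_ord1 !mxE. Qed.

Lemma norm_ssign_outer_le1 x i j : `|ssign_outer x i j| <= 1.
Proof. by rewrite ssign_outerE normrM mulr_ile1 ?norm_ssign_le1. Qed.

(** The case distinction concerns [y] alone. With [y = X_i - t] and [x = X_i - u], the indicator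
    does not depend on the random centre [u], and its mean obeys the strong law. *)
Lemma ssign_outer_dist x y i j (r : R) : 0 < r ->
  `|ssign_outer x i j - ssign_outer y i j| <=
    2 * p.+1%:R * enorm (x - y) / r + 2 * \1_[set z : 'rV[R]_p | enorm z < r] y.
Proof.
move=> r0; rewrite indicE; case: (boolP (y \in _)) => [yr|].
  rewrite (le_trans (ler_normB _ _))// mulr1 -[leLHS]add0r lerD//.
    by rewrite !mulr_ge0 ?enorm_ge0// invr_ge0 ltW.
  by rewrite -[2]/(1 + 1) lerD ?norm_ssign_outer_le1.
rewrite notin_setE/= => /negP; rewrite -leNgt => ry.
rewrite mulr0 addr0 ler_pdivlMr// (le_trans (ler_wpM2l _ ry))//.
rewrite !ssign_outerE.
(* One factor is changed at a time; the other has absolute value at most 1. *)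
have -> : ssign x ord0 i * ssign x ord0 j - ssign y ord0 i * ssign y ord0 j =
    (ssign x ord0 i - ssign y ord0 i) * ssign x ord0 j +
    ssign y ord0 i * (ssign x ord0 j - ssign y ord0 j) by ring.
rewrite (le_trans (ler_wpM2r (enorm_ge0 y) (ler_normD _ _)))// mulrDl.
rewrite -[leRHS]mulrA -[2]/(1 + 1) [leRHS]mulrDl mul1r !normrM lerD//.
  rewrite mulrAC -[leRHS]mulr1 ler_pM ?norm_ssign_le1 ?ssign_dist//.
  by rewrite mulr_ge0 ?enorm_ge0.
rewrite -mulrA -[leRHS]mul1r ler_pM ?norm_ssign_le1 ?ssign_dist//.
by rewrite mulr_ge0 ?enorm_ge0.
Qed.

End SpatialSign.

(** * Measurability of norms and signs, and the Borel structure on row vectors *)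

Section Measurability.
Context {R : realType} {p : nat} {d : measure_display} {T : measurableType d}.

Lemma measurable_enorm (Y : T -> 'rV[R]_p) :
  (forall j, measurable_fun setT (fun z => Y z ord0 j)) ->
  measurable_fun setT (fun z => enorm (Y z)).
Proof.
move=> mY.
have -> : (fun z => enorm (Y z)) =
    (fun z => (\sum_(j < p) Y z ord0 j ^+ 2) `^ 2^-1).
  apply/funext => z; rewrite powR12_sqrt// sumr_ge0// => j _.
  by rewrite sqr_ge0.
apply: (measurableT_comp (measurable_powR _)).
by apply: measurable_sum => j; exact: measurable_funX.
Qed.

Lemma measurable_ssign_outer (Y : T -> 'rV[R]_p) i j :
  (forall k, measurable_fun setT (fun z => Y z ord0 k)) ->
  measurable_fun setT (fun z => ssign_outer (Y z) i j).
Proof.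
move=> mY.
have msign k : measurable_fun setT (fun z => ssign (Y z) ord0 k).
  (* The power -1 agrees with the inverse at 0 too, where both are 0. *)
  have -> : (fun z => ssign (Y z) ord0 k) =
      (fun z => Y z ord0 k * enorm (Y z) `^ (-1)).
    by apply/funext => z; rewrite powR_inv1 ?enorm_ge0// ssign_coordE.
  apply: measurable_funM => //.
  by apply: (measurableT_comp (measurable_powR _)); exact: measurable_enorm.
under eq_fun do rewrite ssign_outerE.
exact: measurable_funM.
Qed.

End Measurability.

Section Borel.
Context (R : realType) (p : nat).

(** The generators of [borel_vec], named so that the sigma-algebra they generate can be attached to
    a type. *)
Definition coord_preimages : set (set 'rV[R]_p) :=
  [set A | exists (j : 'I_p) (B : set R),
     measurable B /\ A = (fun v : 'rV[R]_p => v ord0 j) @^-1` B].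

(* Its measurable sets are convertible to [borel_vec]. *)
Definition borelRV := g_sigma_algebraType coord_preimages.
HB.instance Definition _ := Measurable.on borelRV.

Lemma measurable_coord (j : 'I_p) :
  measurable_fun [set: borelRV] (fun v : borelRV => (v : 'rV[R]_p) ord0 j).
Proof.
move=> _ B mB; rewrite setTI; apply: sub_sigma_algebra.
by exists j, B.
Qed.

Lemma measurable_coordB (t : 'rV[R]_p) (j : 'I_p) :
  measurable_fun [set: borelRV] (fun v : borelRV => ((v : 'rV[R]_p) - t) ord0 j).
Proof.
under eq_fun do rewrite !mxE.
by apply: measurable_funB => //; exact: measurable_coord.
Qed.

Lemma random_vec_measurable {d} {Omega : measurableType d}
    (Y : Omega -> 'rV[R]_p) :
  random_vec Y -> measurable_fun setT (Y : Omega -> borelRV).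
Proof. by move=> Yrv _ B mB; rewrite setTI; exact: Yrv. Qed.

End Borel.

(** * The random envelope *)

Section Envelope.
Context (R : realType) (d : measure_display) (Omega : measurableType d).
Variables (P : probability Omega R) (p : nat).
Variables (X : nat -> Omega -> 'rV[R]_p) (t : 'rV[R]_p).
Hypothesis Xrv : forall i, random_vec (X i).
Hypothesis Xind : mutually_independent P X.
Hypothesis Xid : identically_distributed P X.

Let XV i : Omega -> borelRV R p := X i.

Let mX i : measurable_fun setT (XV i).
Proof. exact: random_vec_measurable. Qed.

Let X_indep i j (A B : set (borelRV R p)) : i != j -> measurable A -> measurable B ->
  P ((XV i @^-1` A) `&` (XV j @^-1` B)) = (P (XV i @^-1` A) * P (XV j @^-1` B))%E.
Proof.
move=> ij mA mB.
(* Mutual independence for a two-element index list, with [A] at [i] and [B] at any other index. *)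
have := Xind [:: i; j] (fun k => if k == i then A else B).
rewrite /= inE ij => /(_ isT).
have -> : \bigcap_(k in [set` [:: i; j]]) (X k @^-1` (if k == i then A else B)) =
    (XV i @^-1` A) `&` (XV j @^-1` B).
  apply/seteqP; split => w /=.
    move=> H; split.
      by have := H i; rewrite /= inE eqxx; apply.
    by have := H j; rewrite /= !inE eqxx orbT eq_sym (negbTE ij); apply.
  move=> [Ai Bj] k /=; rewrite !inE => /orP[/eqP ->|/eqP ->]; rewrite ?eqxx//.
  by rewrite eq_sym (negbTE ij).
rewrite big_cons big_seq1 eqxx eq_sym (negbTE ij); apply.
by move=> k _; case: ifP.
Qed.

Let menorm : measurable_fun setT (fun w => enorm (X 0%N w - t)).
Proof.
apply: measurable_enorm => j.
exact: (measurableT_comp (measurable_coordB R p t j) (mX 0%N)).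
Qed.

Let slln := slln_bounded_iid P XV mX Xid X_indep.

(** The integrand is [+oo] exactly where [X = t], and an integrable function is finite almost
    everywhere. *)
Lemma neg_moment_no_atom (alpha : R) :
  (neg_moment P (X 0%N) t alpha < +oo)%E ->
  P [set w | enorm (X 0%N w - t) = 0] = 0%E.
Proof.
rewrite /neg_moment; set f := (fun w => if _ then _ else _) => foo.
have mnorm : measurable_fun setT (fun w => enorm (X 0%N w - t)) by exact: menorm.
have mf : measurable_fun setT f.
  apply: measurable_fun_ifT => //.
    exact: measurable_fun_eqr.
  by apply/measurable_EFinP; apply: (measurableT_comp (measurable_powR _)).
have f0 w : (0 <= f w)%E by rewrite /f; case: ifP => // _; rewrite lee_fin powR_ge0.
have /integrable_ae-/(_ measurableT) : P.-integrable setT f.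
  apply/integrableP; split => //.
  by under eq_integral do rewrite gee0_abs//.
move=> ae_fin; apply/negligibleP; last first.
  apply: negligibleS ae_fin => w /= w0 /(_ I).
  by rewrite /f w0 eqxx.
rewrite [X in measurable X](_ : _ = (fun w => enorm (X 0%N w - t)) @^-1` [set 0])//.
by rewrite -[X in measurable X]setTI; exact: mnorm.
Qed.

(** Continuity from above along the radii [1/(k+1)]: the events decrease to [X = t], which is
    null. *)
Lemma small_ball_probability (eps : R) : 
  P [set w | enorm (X 0%N w - t) = 0] = 0%E -> 0 < eps ->
  exists2 r : R, 0 < r & (P [set w | (enorm (X 0%N w - t) < r)%R] <= eps%:E)%E.
Proof.
move=> no_atom e0.
pose F k := [set w | enorm (X 0%N w - t) < k.+1%:R^-1].
have mF k : measurable (F k) by exact: measurable_lt_set.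
have FI : \bigcap_k F k = [set w | enorm (X 0%N w - t) = 0].
  apply/seteqP; split => w /= => [Fw|w0 k _]; last by rewrite /F/= w0 invr_gt0.
  apply/eqP; rewrite eq_le enorm_ge0 andbT leNgt; apply/negP => w0.
  have [k kw] : exists k : nat, k.+1%:R^-1 < enorm (X 0%N w - t).
    by have [k] := ltr_add_invr w0; rewrite add0r; exists k.
  by have := Fw k I; rewrite /F/= ltNge (ltW kw).
have : (P \o F) @ \oo --> P (\bigcap_k F k).
  apply: nonincreasing_cvg_mu => //.
  - by rewrite ltey_eq fin_num_measure.
  - exact: bigcap_measurable.
  - move=> k l kl; apply/subsetPset => w; rewrite /F/= => /lt_le_trans; apply.
    by rewrite lef_pV2 ?posrE// ler_nat.
rewrite FI no_atom => PF.
have [k _ /(_ k (leqnn k)) Pk] := cvge0_lt _ _ PF _ e0.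
by exists k.+1%:R^-1; [rewrite invr_gt0|exact: ltW].
Qed.

(** [delta] and [D] are chosen before [u], so one envelope serves every sequence of centres and both
    modes of convergence. *)
Lemma SSCM_n_envelope (eps : R) :
  P [set w | enorm (X 0%N w - t) = 0] = 0%E -> 0 < eps ->
  exists (delta : R) (D : nat -> Omega -> R),
  [/\ 0 < delta, forall n, measurable_fun setT (D n),
      {ae P, forall w, (fun n => D n w) @ \oo --> (0 : R)} &
      forall n u w, (0 < n)%N -> enorm (u w - t) <= delta ->
        `|SSCM_n X n u w - SSCM P (X 0%N) t| <= eps + D n w].
Proof.
move=> no_atom e0.
(* The ball frequency enters with factor 2, so [eps / 4] uses half of [eps]; the displacement of the
   centre uses the other half. *)
have [r r0 Pr] := small_ball_probability (eps / 4) no_atom ltac:(by rewrite divr_gt0).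
pose gB : borelRV R p -> R := \1_[set v : borelRV R p | enorm (v - t) < r].
pose gS i j : borelRV R p -> R := fun v => ssign_outer (v - t) i j.
have mB : measurable_fun setT gB.
  apply: measurable_indic; apply: measurable_lt_set.
  by apply: measurable_enorm => k; exact: measurable_coordB.
have mS i j : measurable_fun setT (gS i j).
  by apply: measurable_ssign_outer => k; exact: measurable_coordB.
have gB1 v : `|gB v| <= 1 by rewrite /gB indicE; case: (_ \in _); rewrite ?normr1 ?normr0.
have gS1 i j v : `|gS i j v| <= 1 by exact: norm_ssign_outer_le1.
pose mean (g : borelRV R p -> R) n w := n%:R^-1 * \sum_(i < n) g (XV i w).
pose dev (g : borelRV R p -> R) n w := mean g n w - Rintegral P setT (g \o XV 0%N).
have mdev (g : borelRV R p -> R) n : measurable_fun setT g -> measurable_fun setT (dev g n).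
  move=> mg; apply: measurable_funB => //; apply: measurable_funM => //.
  by apply: measurable_sum => i; exact: measurableT_comp.
have dev0 (g : borelRV R p -> R) : measurable_fun setT g -> (forall v, `|g v| <= 1) ->
    {ae P, forall w, (fun n => `|dev g n w|) @ \oo --> (0 : R)}.
  move=> mg g1; apply: filterS (slln g 1 mg g1) => w mean_cvg.
  apply/norm_cvg0P; rewrite -(subrr (Rintegral P setT (g \o XV 0%N))).
  by apply: cvgB => //; exact: cvg_cst.
(* Summing over all entries gives one scalar that dominates the deviation of each entry. *)
pose D n w := 2 * `|dev gB n w| + \sum_(ij : 'I_p * 'I_p) `|dev (gS ij.1 ij.2) n w|.
(* Chosen so that [2 (p+1) delta / r = eps / 2]. *)
exists (eps * r / (4 * p.+1%:R)), D; split.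
- by rewrite divr_gt0 ?mulr_gt0.
- move=> n; apply: measurable_funD.
    by apply: measurable_funM => //; apply: measurableT_comp => //; exact: mdev.
  by apply: measurable_sum => ij; apply: measurableT_comp => //; exact: mdev.
- have : {ae P, forall w, forall ij : 'I_p * 'I_p,
      (fun n => `|dev (gS ij.1 ij.2) n w|) @ \oo --> (0 : R)}.
    by apply: filter_forall => ij; apply: dev0.
  apply: filterS2 (dev0 gB mB gB1) => w cB cS.
  rewrite -[0]addr0; apply: cvgD.
    by rewrite -[0](mulr0 2); apply: cvgMr.
  exact: cvg_sum0.
- move=> n u w n0 ut.
  have D_ge0 : 0 <= \sum_(ij : 'I_p * 'I_p) `|dev (gS ij.1 ij.2) n w|.
    by apply: sumr_ge0.
  apply: norm_mx_le => [|i j].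
    by rewrite addr_ge0 ?addr_ge0 ?mulr_ge0// ltW.
  have meanS : `|(SSCM_n X n u w) i j - mean (gS i j) n w| <=
      eps / 2 + 2 * mean gB n w.
    have -> : (SSCM_n X n u w) i j - mean (gS i j) n w = n%:R^-1 *
        \sum_(k < n) (ssign_outer (X k w - u w) i j - ssign_outer (X k w - t) i j).
      by rewrite sumrB mulrBr !mxE summxE.
    have -> : eps / 2 + 2 * mean gB n w =
        n%:R^-1 * \sum_(k < n) (eps / 2 + 2 * gB (XV k w)).
      rewrite big_split/= sumr_const card_ord -mulr_sumr mulrDr.
      rewrite -[(eps / 2) *+ n]mulr_natl mulKf ?pnatr_eq0 -?lt0n//.
      by rewrite /mean mulrCA.
    rewrite normrM ger0_norm ?invr_ge0// ler_wpM2l ?invr_ge0//.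
    rewrite (le_trans (ler_norm_sum _ _ _))// ler_sum// => k _.
    rewrite (le_trans (ssign_outer_dist _ _ _ _ r r0))// lerD//.
    (* The displacement is the same for every observation, so [delta] bounds all summands at
       once. *)
    have -> : X k w - u w - (X k w - t) = - (u w - t).
      by rewrite !opprB addrC addrA subrK.
    rewrite enormN ler_pdivrMr// (le_trans (ler_wpM2l _ ut)) ?mulr_ge0//.
    have p0 : p.+1%:R != 0 :> R by rewrite pnatr_eq0.
    by rewrite le_eqVlt; apply/orP; left; apply/eqP; field.
  have meanB : mean gB n w <= eps / 4 + `|dev gB n w|.
    rewrite -lerBlDl; apply: le_trans (ler_norm _); rewrite lerD2l lerN2.
    have -> : Rintegral P setT (gB \o XV 0%N) =
        fine (P [set w | enorm (X 0%N w - t) < r]).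
      rewrite -[X in P X]setIT -integral_indic//.
      exact: measurable_lt_set.
    by rewrite -lee_fin fineK// fin_num_measure//; exact: measurable_lt_set.
  have devS : `|dev (gS i j) n w| <= \sum_(ij : 'I_p * 'I_p) `|dev (gS ij.1 ij.2) n w|.
    by rewrite (bigD1 (i, j))//= lerDl sumr_ge0.
  (* The matrix centred at [t] is inserted: the first difference comes from moving the centre, the
     second is the deviation of a mean. *)
  have -> : (SSCM_n X n u w - SSCM P (X 0%N) t) i j =
      ((SSCM_n X n u w) i j - mean (gS i j) n w) + dev (gS i j) n w.
    rewrite /dev addrA subrK !mxE; congr (_ - _).
  rewrite (le_trans (ler_normD _ _))// /D; lra.
Qed.

End Envelope.

(** * Both modes of convergence, derived from the envelope *)

Theorem theorem1 (R : realType) (d : measure_display) (Omega : measurableType d)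
  (P : probability Omega R) (p : nat) (hp : (2 <= p)%N)
  (X : nat -> Omega -> 'rV[R]_p) (t : 'rV[R]_p) (alpha : R)
  (halpha : 0 <= alpha)
  (HXrv : forall i, random_vec (X i))
  (Hind : mutually_independent P X)
  (Hid : identically_distributed P X)
  (HI : (neg_moment P (X 0%N) t alpha < +oo)%E) :
  (forall (tn : nat -> Omega -> 'rV[R]_p) (T : nat -> Omega -> R),
     (forall n, random_vec (tn n)) ->
     (forall n, measurable_fun setT (T n)) ->
     (forall n, (0 < n)%N ->
        {ae P, forall w, n%:R `^ alpha * enorm (tn n w - t) <= T n w}) ->
     (if 0 < alpha then {ae P, forall w, cvg ((fun n => T n w) @ \oo)}
      else {ae P, forall w, (fun n => T n w) @ \oo --> 0}) ->
     {ae P, forall w,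
        (fun n => SSCM_n X n (tn n) w) @ \oo --> SSCM P (X 0%N) t})
  /\
  (forall tn : nat -> Omega -> 'rV[R]_p,
     (forall n, random_vec (tn n)) ->
     (if 0 < alpha then
        (* bounded in probability *)
        forall eps : R, 0 < eps -> exists M : R, forall n,
          (P [set w | (M < n%:R `^ alpha * enorm (tn n w - t))%R] <= eps%:E)%E
      else
        (* convergence in probability to 0 *)
        forall eps : R, 0 < eps ->
          (fun n => P [set w | eps <= enorm (tn n w - t)]) @ \oo --> 0%E) ->
     forall eps : R, 0 < eps ->
       (fun n => P [set w | eps <= `|SSCM_n X n (tn n) w - SSCM P (X 0%N) t|])
         @ \oo --> 0%E).
Proof.
have no_atom := neg_moment_no_atom _ _ _ _ _ _ t HXrv alpha HI.
have envelope eps := SSCM_n_envelope _ _ _ _ _ X t HXrv Hind Hid eps no_atom.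
split=> [tn T tnrv mT tnT Tcvg|tn tnrv tn_bnd eps e0].
  have tn_close delta : 0 < delta ->
      {ae P, forall w, \forall n \near \oo, enorm (tn n w - t) <= delta}.
    move=> d0.
    (* Countably many null sets are merged, so that one outcome satisfies the rate bound for all
       [n > 0]. *)
    have {tnT} tnT : {ae P, forall w n, (0 < n)%N ->
        n%:R `^ alpha * enorm (tn n w - t) <= T n w}.
      apply: ae_foralln => -[|n]; first exact: aeW.
      by apply: filterS (tnT n.+1 isT) => w + _.
    case: ifPn Tcvg => [a0|]; last first.
      rewrite -leNgt => a_le0; have alpha0 : alpha = 0.
        by apply/eqP; rewrite eq_le a_le0.
      apply: filterS2 tnT => w tnT /cvgrPdist_le/(_ delta d0).
      apply: filterS2 (nbhs_infty_gt 0) => n n0; rewrite sub0r normrN => Tn.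
      have := tnT n n0; rewrite alpha0 powRr0 mul1r => /le_trans; apply.
      exact: le_trans (ler_norm _) Tn.
    apply: filterS2 tnT => w tnT /cvg_ex[/= l Tl].
    (* A sequence converging to [l] is eventually below [|l| + 1], and the diverging factor
       [n^alpha] then forces closeness. *)
    have := near_le_of_rate_le R alpha (`|l| + 1) delta a0 d0.
    move/cvgrPdist_lt : Tl => /(_ 1 ltr01).
    apply: filterS3 (nbhs_infty_gt 0) => n n0 Tn; apply.
    apply: le_trans (tnT n n0) _.
    move: Tn; rewrite distrC => /ltr_normlW; rewrite ltrBlDr addrC => /ltW /le_trans.
    by apply; rewrite lerD2r ler_norm.
  (* Each tolerance has its own null set; the tolerances [1/(k+1)] keep their union null. The factor
     2 allows one tolerance for the envelope and one for [D n w]. *)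
  have ae_close (k : nat) : {ae P, forall w, \forall n \near \oo,
      `|SSCM_n X n (tn n) w - SSCM P (X 0%N) t| <= 2 * k.+1%:R^-1}.
    have [delta [D [d0 mD D0 SD]]] := envelope k.+1%:R^-1 ltac:(by rewrite invr_gt0).
    apply: filterS2 (tn_close delta d0) D0 => w tnw /cvgrPdist_le.
    move=> /(_ k.+1%:R^-1 ltac:(by rewrite invr_gt0)).
    apply: filterS3 (nbhs_infty_gt 0) tnw => n n0 tnw.
    rewrite sub0r normrN => Dn; rewrite (le_trans (SD n (tn n) w n0 tnw))//.
    by rewrite -[2]/(1 + 1) mulrDl mul1r lerD2l (le_trans (ler_norm _) Dn).
  apply: filterS (ae_foralln ae_close) => w Sw.
  apply/cvgrPdist_le => e e0.
  have [k] : exists k : nat, k.+1%:R^-1 < e / 2.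
    have [k] := ltr_add_invr (divr_gt0 e0 (ltr0n _ 2)).
    by rewrite add0r; exists k.
  move=> ke; apply: filterS (Sw k) => n; rewrite distrC => /le_trans; apply.
  by rewrite mulrC -ler_pdivlMr// ltW.
have [delta [D [d0 mD D0 SD]]] := envelope (eps / 2) ltac:(by rewrite divr_gt0).
have mtn n : measurable_fun setT (fun w => enorm (tn n w - t)).
  apply: measurable_enorm => j.
  exact: (measurableT_comp (measurable_coordB R p t j)
    (random_vec_measurable _ _ _ (tnrv n))).
have mA c n : measurable [set w | c < enorm (tn n w - t)].
  exact: measurable_gt_set.
have mS n : measurable_fun setT
    (fun w => `|SSCM_n X n (tn n) w - SSCM P (X 0%N) t|).
  apply: measurable_norm_mx => i j.
  under eq_fun do rewrite !mxE summxE.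
  apply: measurable_funB => //; apply: measurable_funM => //.
  apply: measurable_sum => k; apply: measurable_ssign_outer => l.
  under eq_fun do rewrite !mxE.
  apply: measurable_funB.
  - exact: (measurableT_comp (measurable_coord R p l)
      (random_vec_measurable _ _ _ (HXrv k))).
  - exact: (measurableT_comp (measurable_coord R p l)
      (random_vec_measurable _ _ _ (tnrv n))).
have tn_close e : 0 < e ->
    \forall n \near \oo, (P [set w | (delta < enorm (tn n w - t))%R] <= e%:E)%E.
  case: ifPn tn_bnd => [a0|_] tn_bnd e1.
    have [M HM] := tn_bnd e e1.
    (* For large [n], a distance above [delta] makes the scaled distance exceed [M], an event of
       probability at most [e] for every [n]. *)
    apply: filterS (near_le_of_rate_le R alpha M delta a0 d0) => n Mn.
    apply: le_trans (HM n); apply: le_measure; rewrite ?inE//.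
      by apply: measurable_gt_set; exact: measurable_funM.
    by move=> w /=; rewrite ltNge => tnw; rewrite ltNge; apply: contra tnw; exact: Mn.
  apply: filterS (cvge0_lt _ _ (tn_bnd _ d0) _ e1) => n /ltW; apply: le_trans.
  apply: le_measure; rewrite ?inE//; first exact: measurable_ge_set.
  by move=> w /= /ltW.
apply: cvge0_of_le => // e e_gt0.
have e2 : 0 < e / 2 by rewrite divr_gt0.
have eps2 : 0 < eps / 2 by rewrite divr_gt0.
have := cvge0_lt _ _ (ae_cvg0_probability P D (eps / 2) mD D0 eps2) _ e2.
apply: filterS3 (nbhs_infty_gt 0) (tn_close _ e2) => n n0 Ptn PD.
pose A := [set w | delta < enorm (tn n w - t)].
pose B := [set w | eps / 2 <= `|D n w|].
have mAn : measurable A by exact: mA.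
have mB : measurable B by apply: measurable_ge_set; exact: measurableT_comp.
(* Outside [A] the envelope gives [eps <= eps / 2 + D n w], which places the outcome in [B]; each
   event has probability below or equal to [e / 2]. *)
apply: (@le_trans _ _ (P (A `|` B))).
  apply: le_measure; rewrite ?inE//; [exact: measurable_ge_set|exact: measurableU|].
  move=> w /= Sw; have [tnw|] := leP (enorm (tn n w - t)) delta; [right|by left].
  have := SD n (tn n) w n0 tnw; have := ler_norm (D n w).
  by rewrite /B/=; lra.
apply: le_trans (measureU2 _ _ _) _ => //.
have -> : e%:E = ((e / 2)%:E + (e / 2)%:E)%E by rewrite -EFinD; congr EFin; lra.
by apply: leeD => //; exact: ltW.
Qed.
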